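(* Let $n$ and $k$ be even integers with $k>2$ and $n>2k$, and let $r$ be the remainder of $n$ modulo $2k$ (so $0\le r<2k$). Then $$\alpha(P(n,k)) \geq (2k-1)\left\lfloor\frac{n}{2k}\right\rfloor + \begin{cases} \frac{r}{2} & \text{if } r\leq k,\\[2pt] \frac{3r}{2}-k-1 & \text{if } r>k.\end{cases}$$
   Context: For positive integers $n,k$ with $n>2k$, the generalized Petersen graph $P(n,k)$ is the graph with vertex set $\{u_i,v_i : i=1,\dots,n\}$ (so $2n$ vertices) and edge set $\{u_iu_{i+1},\ u_iv_i,\ v_iv_{i+k} : i=1,\dots,n\}$, subscripts being reduced modulo $n$. For a graph $G$, $\alpha(G)$ denotes the independence number, i.e. the size of a largest set of pairwise non-adjacent vertices. *)

(* Defs.v *)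
From mathcomp Require Import all_boot.
From mathcomp Require Import zify.
Set Implicit Arguments.
Unset Strict Implicit.
Unset Printing Implicit Defensive.

(* A graph on a finite type T is given by its adjacency relation e : rel T. *)

Definition independent (T : finType) (e : rel T) (A : {set T}) : bool :=
  [forall x in A, forall y in A, ~~ e x y].

Definition independence_number (T : finType) (e : rel T) : nat :=
  \max_(A : {set T} | independent e A) #|A|.

(* inl i is the outer vertex u_i and inr i the inner vertex v_i; subscripts
   are the residues 0, ..., n-1, with 0 standing for the subscript n. *)
Definition petersen_vertex (n : nat) : finType := ('I_n + 'I_n)%type.

Definition petersen (n k : nat) : rel (petersen_vertex n) :=
  fun x y =>
    match x, y with
    | inl i, inl j => (j == i + 1 %[mod n]) || (i == j + 1 %[mod n])
    | inl i, inr j => i == j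
    | inr i, inl j => i == j
    | inr i, inr j => (j == i + k %[mod n]) || (i == j + k %[mod n])
    end.

Arguments petersen : clear implicits.

Lemma petersen_sym (n k : nat) : symmetric (petersen n k).
Proof. by move=> [i|i] [j|j] //=; rewrite 1?orbC 1?eq_sym. Qed.

Lemma petersen_irrefl (n k : nat) (hk : 0 < k) (hn : 2 * k < n) :
  irreflexive (petersen n k).
Proof.
have H (i : 'I_n) m : 0 < m < n -> (i == i + m %[mod n]) = false.
  move=> /andP[m0 mn]; rewrite -{1}(addn0 i) eqn_modDl mod0n modn_small //.
  by rewrite eq_sym; apply/negbTE; rewrite -lt0n.
by move=> [i|i] /=; rewrite H //; lia.
Qed.

(* Main.v *)
Require Import Defs.
From mathcomp Require Import all_boot.
From mathcomp Require Import zify.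

Set Implicit Arguments.
Unset Strict Implicit.
Unset Printing Implicit Defensive.

(* Cut the indices 0, ..., n-1 into consecutive intervals of length k.  On the
   intervals of even rank take the u_i with i even and the v_i with i odd, and
   exchange the two parities on those of odd rank.  As k is even, no two
   chosen v_i are at distance k, and two chosen u_i are consecutive only across
   the end of a block of 2k indices, where one u_i is dropped.  This keeps
   2k - 1 vertices per block.  Closing the cycle costs, in the last r indices,
   the vertex u_(n-1) and the v_i lying both in the last k indices and in an
   interval of even rank. *)

Lemma modn_add_eq (n m i j : nat) : i < n -> j < n -> m <= n ->
  (j == i + m %[mod n]) -> j = i + m \/ j + n = i + m.
Proof.
move=> lt_in lt_jn le_mn; rewrite (modn_small lt_jn) => /eqP Ej.
have Eim := divn_eq (i + m) n; rewrite -Ej in Eim.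
have : (i + m) %/ n < 2 by rewrite ltn_divLR; lia.
by case: (_ %/ _) Eim => [|[|//]] ? _; [left | right]; lia.
Qed.

Lemma divn_interval (m d i : nat) : m * d <= i < m.+1 * d -> i %/ d = m.
Proof.
move=> /andP[le_i lt_i]; rewrite -(subnKC le_i) divnMDl; last by lia.
by rewrite divn_small ?addn0; lia.
Qed.

(** Used with [d = 2 * k], where it counts the ends of complete blocks, each costing one outer
    vertex. *)
Lemma count_dvdn_succ (d n : nat) : \sum_(i < n) (d %| i.+1) = n %/ d.
Proof.
elim: n => [|n IHn]; first by rewrite big_ord0 div0n.
rewrite big_ord_recr /= IHn; case: d {IHn} => [|d].
  by rewrite dvd0n !divn0.
by rewrite divnS // addnC.
Qed.

(** There are [m./2] odd indices below [m]. This counts the inner vertices lost to the wrap gap. *)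
Lemma count_odd_interval (a b n : nat) : ~~ odd a -> ~~ odd b ->
  \sum_(i < n) (odd i && (a <= i < b)) = (minn n b)./2 - a./2.
Proof.
move=> even_a even_b; elim: n => [|n IHn]; first by rewrite big_ord0; lia.
by rewrite big_ord_recr /= IHn; lia.
Qed.

Lemma count_eq_ord (m n : nat) (c : bool) :
  \sum_(i < n) ((i == m :> nat) && c) <= c.
Proof.
case: c; last by rewrite big1 // => i _; rewrite andbF.
have [lt_mn|le_nm] := ltnP m n.
  rewrite (bigD1 (Ordinal lt_mn)) //= eqxx big1 // => i.
  by rewrite -val_eqE /= => /negbTE ->.
by rewrite big1 // => i _; have := ltn_ord i; lia.
Qed.

Section Construction.

Variables n k : nat.

(** Here [i %/ k] is the rank of the interval of [i]; the value makes [v_i] a candidate when true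
    and [u_i] when false. *)
Definition twisted_parity (i : nat) : bool := odd (i + i %/ k).

(* The truncated r - k makes the gap contain all the last r indices when
   r <= k. *)
Definition wrap_gap (i : nat) : bool :=
  let q := n %/ (2 * k) in let r := n %% (2 * k) in
  2 * k * q + (r - k) <= i < 2 * k * q + k.

Definition outer_choice (i : nat) : bool :=
  [&& ~~ twisted_parity i, ~~ (2 * k %| i.+1) & i != n.-1].

Definition inner_choice (i : nat) : bool :=
  twisted_parity i && ~~ wrap_gap i.

Definition choice_set : {set petersen_vertex n} :=
  [set x : petersen_vertex n |
    match x with inl i => outer_choice i | inr i => inner_choice i end].

Hypotheses (even_n : ~~ odd n) (even_k : ~~ odd k).
Hypotheses (gt0_k : 0 < k) (lt_2kn : 2 * k < n).

(** A step to [i.+1] flips the twisted parity unless it enters a new interval. Entering one of odd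
    rank [m] starts from an odd [i] in an interval of even rank, where [u_i] is no candidate; for
    even [m], [u_i] was dropped as a block end. *)
Lemma outer_choice_succ (i : nat) :
  outer_choice i -> outer_choice i.+1 -> False.
Proof.
rewrite /outer_choice /twisted_parity.
move=> /and3P[ti ndvd _] /and3P[tS _ _]; move: tS; rewrite divnS //.
case: (boolP (k %| i.+1)) => [/dvdnP[m Em]|_]; last by lia.
have Ei : i %/ k = m.-1.
  by apply: divn_interval; case: m Em => [|m]; lia.
have odd_m : odd m.
  apply: contraNT ndvd => /even_halfK Em2.
  by rewrite Em -Em2 -mul2n mulnAC dvdn_mulr.
have : ~~ odd i.+1 by rewrite Em oddM (negbTE even_k) andbF.
by case: m odd_m Em Ei => // m /= odd_m _ Ei; rewrite Ei in ti; lia.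
Qed.

(** Adding the even [k] keeps the parity of the index and raises the rank by one, so the twisted
    parity flips. *)
Lemma inner_choice_add (i : nat) :
  inner_choice i -> inner_choice (i + k) -> False.
Proof.
rewrite /inner_choice /twisted_parity divnDr ?dvdnn // divnn gt0_k.
by move=> /andP[ti _] /andP[]; lia.
Qed.

(** Since [j < k] has rank 0, [j] is odd, so [i = j + n - k] is odd and needs an interval of even
    rank. Among the last [k] indices, those of even rank form exactly the gap. *)
Lemma inner_choice_wrap (i j : nat) : i < n -> j + n = i + k ->
  inner_choice i -> inner_choice j -> False.
Proof.
move=> lt_in Ej; rewrite /inner_choice /twisted_parity /wrap_gap.
rewrite (@divn_small j); last by lia.
have En := divn_eq n (2 * k); have lt_r := @ltn_pmod n (2 * k).
set q := n %/ _ in En *; set r := n %% _ in En lt_r *.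
have gt0_q : 0 < q by rewrite divn_gt0; lia.
move=> /andP[ti /negP ngap] /andP[tj _].
have odd_i : odd i.
  rewrite addn0 in tj; have := congr1 odd Ej.
  by rewrite !oddD (negbTE even_n) (negbTE even_k) !addbF => <-.
move: ti; rewrite oddD odd_i.
have le_block : 2 * k <= 2 * q * k by rewrite mulnAC leq_pmulr.
have E2kq : 2 * k * q = 2 * q * k by rewrite mulnAC.
rewrite E2kq in En ngap *.
clear E2kq odd_i tj even_n even_k.
(* The rank of [i] is [2 * q - 1], [2 * q] (then [i] is in the gap) or [2 * q + 1]. *)
have [lt_i|ge_i] := ltnP i (2 * q * k).
  have -> : i %/ k = 2 * q - 1.
    by clear ngap; apply: divn_interval; rewrite mulSn mulnBl; lia.
  by rewrite oddB ?muln_gt0 // oddM.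
have [lt_ik|ge_ik] := ltnP i (2 * q * k + k).
  by case: ngap; lia.
have -> : i %/ k = (2 * q).+1.
  by clear ngap; apply: divn_interval; rewrite !mulSn; lia.
by rewrite /= oddM.
Qed.

Lemma choice_set_independent : independent (petersen n k) choice_set.
Proof.
have outerP (i j : 'I_n) : outer_choice i -> outer_choice j ->
    ~~ (j == i + 1 %[mod n]).
  move=> ci cj; apply/negP => /modn_add_eq[||| Ej | Ej] //; try lia.
    by apply: (@outer_choice_succ i) => //; rewrite -addn1 -Ej.
  (* The wrapping edge forces [i = n.-1], which [outer_choice] excludes. *)
  by case/and3P: ci => _ _; have := ltn_ord i; have := ltn_ord j; lia.
have innerP (i j : 'I_n) : inner_choice i -> inner_choice j ->
    ~~ (j == i + k %[mod n]).
  move=> ci cj; apply/negP => /modn_add_eq[||| Ej | Ej] //; try lia.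
    by apply: (@inner_choice_add i) => //; rewrite -Ej.
  exact: (inner_choice_wrap _ Ej).
have mixedP (i : nat) : outer_choice i -> inner_choice i -> False.
  by move=> /andP[/negbTE ti _]; rewrite /inner_choice ti.
apply/forall_inP => -[] i; rewrite inE => ci; apply/forall_inP => -[] j;
  rewrite inE => cj /=.
- by rewrite negb_or !outerP.
- by apply/eqP => Ei; apply: (mixedP j) => //; rewrite -Ei.
- by apply/eqP => Ei; apply: (mixedP j) => //; rewrite -Ei.
- by rewrite negb_or !innerP.
Qed.

(** Each index has one candidate, which is either chosen or charged to one of the three losses. *)
Lemma choice_or_dropped (i : nat) : i < n ->
  1 <= outer_choice i + inner_choice i + (2 * k %| i.+1)
       + ((i == n.-1) && (k < n %% (2 * k))) + (odd i && wrap_gap i).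
Proof.
move=> lt_in; rewrite /outer_choice /inner_choice.
have En := divn_eq n (2 * k).
(* The gap lies in the interval of even rank [2 * q], where [q = n %/ (2 * k)]. *)
have gapP : wrap_gap i -> twisted_parity i = odd i.
  rewrite /wrap_gap /twisted_parity => /andP[ge_i lt_i].
  by rewrite (@divn_interval (2 * (n %/ (2 * k)))); lia.
(* With [r = n %% (2 * k)], the index [n.-1] is a block end if [r = 0] and lies in the gap if
   [0 < r <= k]; only [r > k] gives it a separate charge. *)
have lastP : i = n.-1 -> ~~ wrap_gap i -> ~~ (2 * k %| i.+1) ->
    k < n %% (2 * k).
  by rewrite /wrap_gap => -> ngap; rewrite prednK /dvdn; lia.
case: (boolP (wrap_gap i)) gapP lastP => [_ /(_ isT) -> _ | _ _].
  have odd_last : i = n.-1 -> odd i by lia.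
  case: (boolP (odd i)) odd_last => [_ _|_ odd_last]; first by rewrite addn1.
  by case: (_ %| _) => //; case: eqP => // /odd_last.
case: (twisted_parity i) => //; case: (_ %| _) => //.
by case: eqP => // Ei /(_ Ei isT isT) ->.
Qed.

(** Summing over the [n] indices leaves at least [n] minus the losses: [q] block ends, one more if
    [r > k], and a gap share of [r / 2] if [r <= k] or [k - r / 2] if [r > k]. *)
Lemma card_choice_set :
  let r := n %% (2 * k) in
  (2 * k - 1) * (n %/ (2 * k))
    + (if r <= k then r %/ 2 else (3 * r) %/ 2 - k - 1) <= #|choice_set|.
Proof.
have -> : #|choice_set| = \sum_(i < n) (outer_choice i + inner_choice i).
  rewrite -sum1_card big_mkcond big_sumType big_split.
  by congr (_ + _); apply: eq_bigr => i _; rewrite inE; case: ifP.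
have even_2kq : ~~ odd (2 * k * (n %/ (2 * k))) by lia.
have even_r : ~~ odd (n %% (2 * k)) by have := divn_eq n (2 * k); lia.
have : \sum_(i < n) 1 <= \sum_(i < n) (outer_choice i + inner_choice i
    + (2 * k %| i.+1) + ((i == n.-1 :> nat) && (k < n %% (2 * k)))
    + (odd i && wrap_gap i)).
  by apply: leq_sum => i _; apply: choice_or_dropped.
rewrite sum1_card card_ord 3!big_split /= count_dvdn_succ.
have := @count_eq_ord n.-1 n (k < n %% (2 * k)).
rewrite count_odd_interval; [|lia|lia].
have := divn_eq n (2 * k); rewrite [_ %/ _ * _]mulnC mulnBl mul1n.
have : n %% (2 * k) < 2 * k by rewrite ltn_pmod; lia.
have : n %/ (2 * k) <= 2 * k * (n %/ (2 * k)) by rewrite leq_pmull; lia.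
move: even_2kq even_r.
(* Naming the product [p] makes the goal linear; [q <= p] keeps the truncated [p - q] exact. *)
move: (2 * k * (n %/ (2 * k))) => p; move: (n %/ _) (n %% _) => q r.
set S := \sum_(i < n) (outer_choice _ + _).
set C := \sum_(i < n) _; move: S C => S C.
by case: (leqP r k) => /=; lia.
Qed.

End Construction.

Theorem theorem2 (n k : nat) (hn : ~~ odd n) (hk : ~~ odd k)
    (hk2 : 2 < k) (hnk : 2 * k < n) :
  let r := n %% (2 * k) in
  (2 * k - 1) * (n %/ (2 * k))
    + (if r <= k then r %/ 2 else (3 * r) %/ 2 - k - 1)
  <= independence_number (petersen n k).
Proof.
have gt0_k : 0 < k := ltn_trans (isT : 0 < 2) hk2.
have indep := choice_set_independent hn hk gt0_k hnk.
apply: leq_trans (card_choice_set hn hk gt0_k hnk) _.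
by rewrite /independence_number (bigD1 _ indep) leq_maxl.
Qed.
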